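(* There exist universal constants $0 < c_\ell \le c_u < 5$ such that for all integers $d \ge 1$, $n \ge 1$ and all $\alpha \in [0, 1/4]$, the $\alpha$-private minimax risk for multinomial estimation satisfies \[ c_\ell \max_{k \in \{1, \ldots, d\}} \min\left\{ \frac{1}{k}, \frac{k \log \frac{d}{k}}{n \alpha^2} \right\} \;\le\; \mathfrak{M}_n\left(\Delta_d, \|\cdot\|_2^2, \alpha\right) \;\le\; c_u \min\left\{1, \frac{d}{n\alpha^2}\right\}. \]
   Context: Multinomial model: $\Delta_d = \{\theta \in \mathbb{R}^d : \theta \ge 0, \sum_{j=1}^d \theta_j = 1\}$ is the probability simplex; for $\theta \in \Delta_d$, $P_\theta$ is the distribution on $\{1,\dots,d\}$ with $P_\theta(X = j) = \theta_j$. Data $X_1, \ldots, X_n$ are i.i.d. from $P_\theta$. Local privacy: the statistician observes only private views $Z_1, \ldots, Z_n$ taking values in a measurable space $\mathcal{Z}$ with $\sigma$-field $\sigma(\mathcal{Z})$, where $Z_i$ is drawn from a channel (conditional distribution) $Q(\cdot \mid X_i = x, Z_j = z_j, j \ne i)$. The channel $Q$ is $\alpha$-locally differentially private if \[ \sup\left\{ \frac{Q(S \mid X_i = x, Z_j = z_j, j\neq i)}{Q(S \mid X_i = x', Z_j = z_j, j \ne i)} : S \in \sigma(\mathcal{Z}),\ z_j \in \mathcal{Z},\ x, x' \in \mathcal{X} \right\} \le e^{\alpha} \] for every $i$. Let $\mathcal{Q}_\alpha$ be the set of all such channels. Minimax risk: for a family $\mathcal{P}$ of distributions, a parameter $\theta(P)$,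 a loss $\Phi\circ\rho$, the $\alpha$-private minimax risk is \[ \mathfrak{M}_n(\theta(\mathcal{P}), \Phi\circ\rho, \alpha) = \inf_{\hat\theta,\, Q \in \mathcal{Q}_\alpha} \sup_{P \in \mathcal{P}} \mathbb{E}_{P,Q}\big[\Phi(\rho(\hat\theta(Z_1,\dots,Z_n), \theta(P)))\big], \] the infimum being over all channels in $\mathcal{Q}_\alpha$ and all measurable estimators $\hat\theta$ of the private views, and the expectation over $X_i \stackrel{iid}{\sim} P$ and the channel. Here $\mathfrak{M}_n(\Delta_d, \|\cdot\|_2^2, \alpha)$ denotes this quantity for the multinomial family $\{P_\theta : \theta \in \Delta_d\}$, parameter $\theta$, and loss $\|\hat\theta - \theta\|_2^2$. *)

(* Defs.v *)
From HB Require Import structures.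
From mathcomp Require Import all_boot all_order all_algebra.
From mathcomp Require Import all_classical all_reals all_analysis measurable_realfun.
Set Implicit Arguments. Unset Strict Implicit. Unset Printing Implicit Defensive.
Import Order.TTheory GRing.Theory Num.Theory.
Local Open Scope classical_set_scope.
Local Open Scope ring_scope.

(* ---------- histories of private views: finite sequences of elements of Z,
   with the product sigma-algebra (on each Z^k), i.e. the sigma-algebra
   generated by measurable rectangles A_1 x ... x A_k (k arbitrary). ---------- *)

Fixpoint in_rect {Z : Type} (As : seq (set Z)) (s : seq Z) : Prop :=
  match As, s with
  | [::], [::] => True
  | A :: As', z :: s' => A z /\ in_rect As' s'
  | _, _ => False
  end.

Definition all_measurable {dZ} {Z : measurableType dZ} (As : seq (set Z)) : Prop :=
  foldr (fun A P => measurable A /\ P) True As.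

Definition histT (Z : Type) := seq Z.
HB.instance Definition _ (Z : choiceType) := Choice.on (histT Z).
HB.instance Definition _ (Z : choiceType) := isPointed.Build (histT Z) [::].

Definition hist_gen {dZ} (Z : measurableType dZ) : set (set (histT Z)) :=
  [set C : set (histT Z) | exists As : seq (set Z),
      all_measurable As /\ C = [set s | in_rect As s]].

Definition hist {dZ} (Z : measurableType dZ) := g_sigma_algebraType (@hist_gen _ Z).

Definition simplex (R : realType) (d : nat) : set ('I_d -> R) :=
  [set th | (forall j, 0 <= th j) /\ \sum_(j < d) th j = 1].

Definition sqloss (R : realType) (d : nat) (u v : 'I_d -> R) : R :=
  \sum_(j < d) (u j - v j) ^+ 2.

(* A sequentially interactive channel: Z_{i+1} ~ Q (X_{i+1}) (z_1,...,z_i).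
   It is alpha-locally differentially private if, for every history, every
   measurable S and all x, x': Q x hist S <= e^alpha Q x' hist S. *)
Definition is_LDP_channel (R : realType) (alpha : R) (d : nat)
  {dZ} {Z : measurableType dZ} (Q : 'I_d -> hist Z -> probability Z R) : Prop :=
  (forall (x : 'I_d) (S : set Z), measurable S ->
     measurable_fun setT (fun s : hist Z => Q x s S)) /\
  (forall (x x' : 'I_d) (s : hist Z) (S : set Z), measurable S ->
     (Q x s S <= (expR alpha)%:E * Q x' s S)%E).

Definition is_estimator (R : realType) (d : nat) {dZ} {Z : measurableType dZ}
  (est : hist Z -> 'I_d -> R) : Prop :=
  forall j, measurable_fun setT (fun s : hist Z => est s j).

(* E_{theta,Q}[ loss(est(Z_1..Z_n), theta) ], computed by iterating: given the
   history s, draw X ~ theta (independent of the past), then Z ~ Q X s. *)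
Fixpoint risk_from (R : realType) (d : nat) {dZ} {Z : measurableType dZ}
  (Q : 'I_d -> hist Z -> probability Z R) (est : hist Z -> 'I_d -> R)
  (th : 'I_d -> R) (m : nat) (s : hist Z) : \bar R :=
  match m with
  | 0 => (sqloss (est s) th)%:E
  | m'.+1 => (\sum_(x < d) (th x)%:E *
              \int[Q x s]_z risk_from Q est th m' (rcons s z : hist Z))%E
  end.

Definition risk (R : realType) (d n : nat) {dZ} {Z : measurableType dZ}
  (Q : 'I_d -> hist Z -> probability Z R) (est : hist Z -> 'I_d -> R)
  (th : 'I_d -> R) : \bar R :=
  risk_from Q est th n ([::] : hist Z).

Definition private_minimax (R : realType) (d n : nat) (alpha : R) : \bar R :=
  ereal_inf [set r : \bar R | exists (dZ : measure_display) (Z : measurableType dZ)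
      (Q : 'I_d -> hist Z -> probability Z R) (est : hist Z -> 'I_d -> R),
      is_LDP_channel alpha Q /\ is_estimator est /\
      r = ereal_sup [set risk n Q est th | th in @simplex R d]].

(* extended-real quotient a / b, with a/0 = +oo for a > 0 and 0/0 = 0 *)
Definition ediv (R : realType) (a b : R) : \bar R := (a%:E * (b%:E)^-1)%E.

Definition lower_rate (R : realType) (d n : nat) (alpha : R) : \bar R :=
  \big[Order.max/-oo%E]_(k < d)
     Order.min ((k.+1%:R)^-1)%:E
       (ediv (k.+1%:R * ln (d%:R / k.+1%:R)) (n%:R * alpha ^+ 2)).

Definition upper_rate (R : realType) (d n : nat) (alpha : R) : \bar R :=
  Order.min 1%E (ediv d%:R (n%:R * alpha ^+ 2)).

(* Main.v *)
(** Upper bound.  Each view is a vector of {-1,1}^d with independent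
coordinates, uniform except for the coordinate X, whose mean is tau; its
likelihood ratios are at most (1 + tau)/(1 - tau).  The coordinatewise average
of the views divided by tau is unbiased, with total variance at most
d/(n tau^2), and tau can be taken to be 9 alpha/20.

Lower bound.  Split km coordinates into k blocks of size m and put mass eta on
one coordinate v_b of each block b.  Compare v with v[b := u0]: given the past,
the two laws of the next view differ by eta (Q x - Q x'), so alpha-privacy
bounds their conditional chi-square divergence by (eta beta)^2, where
beta = e^alpha (e^alpha - 1), whatever the history.  Hence
P_v(A)^2 <= K P_{v[b := u0]}(A) with K = (1 + (eta beta)^2)^n.  For fixed b the
events "the estimator is close to v on block b" are disjoint for distinct
values of v_b, so on average over v they have probability at most
(1 + K/m)/2.  When K <= 3m/4 every block costs a fixed fraction of eta^2.
Working block by block, rather than with a packing of the whole simplex, is what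
makes the argument valid for sequentially interactive channels. *)
Require Import Defs.
From HB Require Import structures.
From mathcomp Require Import all_boot all_order all_algebra.
From mathcomp Require Import all_classical all_reals all_analysis measurable_realfun.
From mathcomp Require Import lra ring zify.
Set Implicit Arguments. Unset Strict Implicit. Unset Printing Implicit Defensive.
Import Order.TTheory GRing.Theory Num.Theory.
Local Open Scope classical_set_scope.
Local Open Scope ring_scope.

(** * Channels as probability kernels *)

Section channel_kernel.
Context (R : realType) {dX dY : measure_display} {X : measurableType dX}
  {Y : measurableType dY} (P : X -> probability Y R).
Hypothesis mP : forall S, measurable S -> measurable_fun setT (fun x => P x S).

(** A plain map into measures, on which the kernel structure can be declared; that structure yields
    measurability of integrals depending on a parameter. *)
Definition channel_measure (x : X) : {measure set Y -> \bar R} := P x.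
HB.instance Definition _ :=
  isKernel.Build _ _ X Y R channel_measure mP.
HB.instance Definition _ := Kernel_isProbability.Build _ _ X Y R
  channel_measure (fun x => probability_setT (P x)).

Lemma measurable_fun_integral_channel (f : X * Y -> \bar R) :
  (forall u, 0 <= f u)%E -> measurable_fun setT f ->
  measurable_fun setT (fun x => \int[P x]_y f (x, y))%E.
Proof.
move=> f0 mf.
exact: (measurable_fun_integral_finite_kernel _ channel_measure f0 mf).
Qed.

End channel_kernel.

(** * The sigma-algebra on histories *)

Section histories.
Context {dZ : measure_display} {Z : measurableType dZ}.

Lemma in_rect_rcons (As : seq (set Z)) (s : seq Z) (z : Z) :
  in_rect As (rcons s z) <->
  exists As' A, [/\ As = rcons As' A, in_rect As' s & A z].
Proof.
elim: s As => [|y s IH] [|A As] /=.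
- by split=> // -[[|B Bs] [C [//]]].
- case: As => [|B Bs] /=.
    split=> [[Az _]|[[|C Cs] [D [/=]]]].
    + by exists [::], A; split.
    + by case=> -> _.
    + by case=> _; case: Cs.
  split=> [[]//|[[|C Cs] [D [/=]]]//].
- by split=> // -[[|B Bs] [C [//]]].
- split=> [[Ay /IH[As' [B [-> ss Bz]]]]|[[|C Cs] [D [/= [-> ->] //]]]].
    by exists (A :: As'), B; split.
  by move=> [Cy ss] Dz; split=> //; apply/IH; exists Cs, D.
Qed.

Lemma all_measurable_rcons (As : seq (set Z)) (A : set Z) :
  all_measurable (rcons As A) <-> all_measurable As /\ measurable A.
Proof. by rewrite /all_measurable; elim: As => [|B Bs IH] /=; tauto. Qed.

Lemma measurable_rect (As : seq (set Z)) :
  all_measurable As -> measurable ([set s | in_rect As s] : set (hist Z)).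
Proof. by move=> mAs; apply: sub_sigma_algebra; exists As. Qed.

(** It suffices to pull back generators: a nonempty rectangle pulls back to a shorter rectangle
    times its last factor, and the empty one to the empty set. *)
Lemma measurable_rcons :
  measurable_fun setT (fun u : hist Z * Z => rcons u.1 u.2 : hist Z).
Proof.
refine (@measurability _ _ (hist Z * Z)%type (hist Z) setT _ (@hist_gen _ Z) erefl _).
move=> _ [_ [As [mAs ->]] <-].
rewrite setTI; have [->|[As' [A eAs]]] : As = [::] \/ exists As' A, As = rcons As' A.
- by case/lastP: As mAs => [|As' A] _; [left|right; exists As', A].
- rewrite (_ : _ @^-1` _ = set0) //.
  apply/seteqP; split=> // -[s z] h.
  by have [[|? ?] [? []]] := (in_rect_rcons [::] s z).1 h.
- rewrite (_ : _ @^-1` _ = [set s | in_rect As' s] `*` A).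
    have := mAs; rewrite eAs all_measurable_rcons => -[mAs' mA].
    by apply: measurableX => //; exact: measurable_rect.
  apply/seteqP; split=> -[s z] => [h|[ss Az]].
    have [Bs [B []]] := (in_rect_rcons As s z).1 h.
    by rewrite eAs => /rcons_inj[-> ->].
  by apply/(in_rect_rcons As s z); exists As', A.
Qed.

Lemma measurable_rcons_r (s : hist Z) :
  measurable_fun setT (fun z : Z => rcons s z : hist Z).
Proof.
exact: (measurableT_comp measurable_rcons (pair1_measurable s)).
Qed.

End histories.

(** * Iterated expectations along the interaction *)

Section iterated_expectation.
Context (R : realType) (d : nat) {dZ : measure_display} {Z : measurableType dZ}.
Variable Q : 'I_d -> hist Z -> probability Z R.
Hypothesis mQ : forall x S, measurable S ->
  measurable_fun setT (fun s : hist Z => Q x s S).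
Implicit Types (g : hist Z -> \bar R) (th : 'I_d -> R) (s : hist Z).
Local Open Scope ereal_scope.

(** The recursion of [risk_from] with an arbitrary terminal payoff [g], so that one calculus serves
    both losses and probabilities of events. *)
Fixpoint iterE th g (m : nat) s : \bar R :=
  if m is m'.+1 then
    \sum_(x < d) (th x)%:E * \int[Q x s]_z iterE th g m' (rcons s z : hist Z)
  else g s.

Lemma risk_fromE est th m s :
  risk_from Q est th m s = iterE th (fun t => (sqloss (est t) th)%:E) m s.
Proof.
elim: m s => //= m IH s; apply: eq_bigr => x _; congr (_ * _).
by apply: eq_integral => z _; rewrite IH.
Qed.

Section fixed_parameter.
Variable th : 'I_d -> R.
Hypothesis th0 : forall x, (0 <= th x)%R.

Lemma iterE_ge0 g m s : (forall t, 0 <= g t) -> 0 <= iterE th g m s.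
Proof.
move=> g0; elim: m s => //= m IH s; apply: sume_ge0 => x _.
by apply: mule_ge0; rewrite ?lee_fin//; apply: integral_ge0.
Qed.

Lemma measurable_iterE g m : (forall t, 0 <= g t) -> measurable_fun setT g ->
  measurable_fun setT (iterE th g m).
Proof.
move=> g0 mg; elim: m => //= m IH; apply: emeasurable_sum => x _.
apply: measurable_funeM.
apply: (@measurable_fun_integral_channel _ _ _ _ _ (Q x) (mQ x)
  (fun u => iterE th g m (rcons u.1 u.2))).
- by move=> u; exact: iterE_ge0.
- exact: (measurableT_comp IH measurable_rcons).
- by [].
Qed.

Lemma measurable_iterE_rcons g m s : (forall t, 0 <= g t) ->
  measurable_fun setT g ->
  measurable_fun setT (fun z : Z => iterE th g m (rcons s z : hist Z)).
Proof.
move=> g0 mg.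
exact: (measurableT_comp (measurable_iterE m g0 mg) (measurable_rcons_r s)).
Qed.

Lemma le_iterE g1 g2 m s : (forall t, 0 <= g1 t) ->
  measurable_fun setT g1 -> measurable_fun setT g2 ->
  (forall t, g1 t <= g2 t) -> iterE th g1 m s <= iterE th g2 m s.
Proof.
move=> g10 mg1 mg2 g12.
have g20 t : 0 <= g2 t by exact: le_trans (g12 t).
elim: m s => //= m IH s; apply: lee_sum => x _.
apply: lee_wpmul2l; first by rewrite lee_fin.
apply: ge0_le_integral => //.
- by move=> z _; exact: iterE_ge0.
- exact: measurable_iterE_rcons.
- exact: measurable_iterE_rcons.
Qed.

Lemma iterED g1 g2 m s : (forall t, 0 <= g1 t) -> (forall t, 0 <= g2 t) ->
  measurable_fun setT g1 -> measurable_fun setT g2 ->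
  iterE th (fun t => g1 t + g2 t) m s = iterE th g1 m s + iterE th g2 m s.
Proof.
move=> g10 g20 mg1 mg2; elim: m s => //= m IH s.
rewrite -big_split/=; apply: eq_bigr => x _.
under eq_integral do rewrite IH.
rewrite ge0_integralD//; first last.
- exact: measurable_iterE_rcons.
- by move=> z _; exact: iterE_ge0.
- exact: measurable_iterE_rcons.
- by move=> z _; exact: iterE_ge0.
by rewrite ge0_muleDr//; apply: integral_ge0 => z _; exact: iterE_ge0.
Qed.

Lemma iterEZ (c : R) g m s : (0 <= c)%R -> (forall t, 0 <= g t) ->
  measurable_fun setT g ->
  iterE th (fun t => c%:E * g t) m s = c%:E * iterE th g m s.
Proof.
move=> c0 g0 mg; elim: m s => //= m IH s.
rewrite ge0_sume_distrr; last first.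
  move=> x _; apply: mule_ge0; rewrite ?lee_fin//.
  by apply: integral_ge0 => z _; exact: iterE_ge0.
apply: eq_bigr => x _; under eq_integral do rewrite IH.
rewrite ge0_integralZl_EFin//; first by rewrite muleCA.
- by move=> z _; exact: iterE_ge0.
- exact: measurable_iterE_rcons.
Qed.

Lemma iterE_sum (I : Type) (r : seq I) (g : I -> hist Z -> \bar R) m s :
  (forall i t, 0 <= g i t) -> (forall i, measurable_fun setT (g i)) ->
  iterE th (fun t => \sum_(i <- r) g i t) m s = \sum_(i <- r) iterE th (g i) m s.
Proof.
move=> g0 mg; elim: r => [|i r IH].
  rewrite big_nil (_ : (fun _ => _) = cst 0); last first.
    by apply/funext => t; rewrite big_nil.
  elim: m s => //= m IH s; rewrite big1// => x _.
  by under eq_integral do rewrite IH; rewrite integral0 mule0.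
rewrite big_cons -IH -iterED//.
- by congr (iterE _ _ m s); apply/funext => t; rewrite big_cons.
- by move=> t; apply: sume_ge0.
- exact: emeasurable_sum.
Qed.

Hypothesis th1 : (\sum_(x < d) th x = 1)%R.

Lemma iterE_cst (c : R) m s : iterE th (cst c%:E) m s = c%:E.
Proof.
elim: m s => //= m IH s.
under eq_bigr => x _.
  under eq_integral do rewrite IH.
  rewrite (integral_cst (Q x s)) //= probability_setT mule1 -EFinM.
  over.
by rewrite sumEFin -mulr_suml th1 mul1r.
Qed.

Lemma iterE_le1 g m s : (forall t, 0 <= g t <= 1) -> measurable_fun setT g ->
  iterE th g m s <= 1.
Proof.
move=> g01 mg; rewrite -[leRHS](iterE_cst 1 m s); apply: le_iterE => //.
- by move=> t; case/andP: (g01 t).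
- by move=> t; case/andP: (g01 t).
Qed.

End fixed_parameter.
End iterated_expectation.

(** * Real-valued expectations of bounded functions *)

Section bounded_measurable.
Context (R : realType) {dZ : measure_display} {Z : measurableType dZ}.
Implicit Types (f g : Z -> R) (P : probability Z R).

Definition bounded_measurable f :=
  measurable_fun setT f /\ exists M, forall z, `|f z| <= M.

Lemma bounded_measurable_cst (c : R) : bounded_measurable (fun=> c).
Proof. by split; [exact: measurable_cst|exists `|c|]. Qed.

Lemma bounded_measurableD f g : bounded_measurable f -> bounded_measurable g ->
  bounded_measurable (fun z => f z + g z).
Proof.
move=> [mf [M Mf]] [mg [N Ng]]; split; first exact: measurable_funD.
by exists (M + N) => z; rewrite (le_trans (ler_normD _ _))// lerD.
Qed.

Lemma bounded_measurableM f g : bounded_measurable f -> bounded_measurable g ->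
  bounded_measurable (fun z => f z * g z).
Proof.
move=> [mf [M Mf]] [mg [N Ng]]; split; first exact: measurable_funM.
by exists (M * N) => z; rewrite normrM ler_pM.
Qed.

Lemma bounded_measurableZ (c : R) f : bounded_measurable f ->
  bounded_measurable (fun z => c * f z).
Proof. exact/bounded_measurableM/bounded_measurable_cst. Qed.

Lemma bounded_measurable_max0 f : bounded_measurable f ->
  bounded_measurable (fun z => Num.max (f z) 0).
Proof.
move=> [mf [M Mf]]; split; first exact: measurable_maxr.
exists M => z; rewrite (le_trans _ (Mf z))//; case: (leP (f z) 0) => _ //.
by rewrite normr0.
Qed.

Lemma bounded_measurable_integrable P f : bounded_measurable f ->
  P.-integrable setT (EFin \o f).
Proof.
move=> [mf [M Mf]]; apply: measurable_bounded_integrable => //.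
  by rewrite /= probability_setT ltry.
exists M; split; first exact: num_real.
by move=> x Mx y _; apply: le_trans (Mf y) _; exact: ltW.
Qed.

Lemma expectationD P f g : bounded_measurable f -> bounded_measurable g ->
  \int[P]_z (f z + g z) = \int[P]_z f z + \int[P]_z g z.
Proof. by move=> bf bg; rewrite RintegralD//; exact: bounded_measurable_integrable. Qed.

Lemma expectationZ P (c : R) f : bounded_measurable f ->
  \int[P]_z (c * f z) = c * \int[P]_z f z.
Proof. by move=> bf; rewrite RintegralZl//; exact: bounded_measurable_integrable. Qed.

Lemma expectation_cst P (c : R) : \int[P]_z c = c.
Proof. by rewrite Rintegral_cst//= probability_setT /= mulr1. Qed.

Lemma le_expectation P f g : bounded_measurable f -> bounded_measurable g ->
  (forall z, f z <= g z) -> \int[P]_z f z <= \int[P]_z g z.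
Proof.
by move=> bf bg fg; apply: le_Rintegral => //; exact: bounded_measurable_integrable.
Qed.

Lemma expectationE P f : bounded_measurable f ->
  ((\int[P]_z f z)%:E = \int[P]_z (f z)%:E)%E.
Proof.
move=> bf; rewrite /Rintegral fineK//.
by apply: integrable_fin_num => //; exact: bounded_measurable_integrable.
Qed.

(** Carries privacy from events to nonnegative test functions: the right side is the integral
    against the scaled measure [c * P'], which dominates [P]. *)
Lemma le_expectation_measure P P' (c : R) f : 0 <= c -> bounded_measurable f ->
  (forall z, 0 <= f z) ->
  (forall S, measurable S -> P S <= c%:E * P' S)%E ->
  \int[P]_z f z <= c * \int[P']_z f z.
Proof.
move=> c0 bf f0 PP'; rewrite -lee_fin EFinM !expectationE//.
have -> : c = (NngNum c0)%:num by [].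
have mf : measurable_fun setT (EFin \o f) by apply/measurable_EFinP; case: bf.
rewrite -ge0_integral_mscale//.
  by apply: ge0_le_measure_integral => // z; rewrite lee_fin.
by move=> z _; rewrite lee_fin.
Qed.

End bounded_measurable.

(** * The chi-square bound for a single view *)

Section one_step.
Context (R : realType) (d : nat) {dZ : measure_display} {Z : measurableType dZ}.
Variable P : 'I_d -> probability Z R.
Variable alpha : R.
Hypothesis alpha0 : 0 <= alpha.
Hypothesis ldp : forall x x' S, measurable S ->
  (P x S <= (expR alpha)%:E * P x' S)%E.
Variable th : 'I_d -> R.
Hypothesis th0 : forall x, 0 <= th x.
Hypothesis th1 : \sum_(x < d) th x = 1.
Implicit Types f h : Z -> R.

(** Expectation under the marginal law of the next view, with the past fixed and X drawn from
    [th]. *)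
Definition mix f : R := \sum_(x < d) th x * \int[P x]_z f z.

Lemma mixD f h : bounded_measurable f -> bounded_measurable h ->
  mix (fun z => f z + h z) = mix f + mix h.
Proof.
move=> bf bh; rewrite /mix -big_split/=; apply: eq_bigr => x _.
by rewrite expectationD// mulrDr.
Qed.

Lemma mixZ (c : R) f : bounded_measurable f ->
  mix (fun z => c * f z) = c * mix f.
Proof.
move=> bf; rewrite /mix mulr_sumr; apply: eq_bigr => x _.
by rewrite expectationZ// mulrCA.
Qed.

Lemma mix_cst (c : R) : mix (fun=> c) = c.
Proof.
by rewrite /mix; under eq_bigr do rewrite expectation_cst; rewrite -mulr_suml th1 mul1r.
Qed.

Lemma le_mix f h : bounded_measurable f -> bounded_measurable h ->
  (forall z, f z <= h z) -> mix f <= mix h.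
Proof.
move=> bf bh fh; apply: ler_sum => x _; apply: ler_wpM2l => //.
exact: le_expectation.
Qed.

Lemma mix_sqr f : bounded_measurable f ->
  mix f ^+ 2 <= mix (fun z => f z * f z).
Proof.
move=> bf; have bff := bounded_measurableM bf bf.
have b2 := bounded_measurableZ (- (2 * mix f)) bf.
have bc := bounded_measurable_cst (Z := Z) (mix f ^+ 2).
have : mix (fun=> 0) <=
    mix (fun z => f z * f z + (- (2 * mix f) * f z + mix f ^+ 2)).
  apply: le_mix; first exact: bounded_measurable_cst.
    by apply: bounded_measurableD => //; exact: bounded_measurableD.
  move=> z; rewrite [leRHS](_ : _ = (f z - mix f) ^+ 2) ?sqr_ge0//.
  by ring.
rewrite mixD//; last exact: bounded_measurableD.
rewrite mixD// mixZ// !mix_cst.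
lra.
Qed.

(** Privacy gives E_x f - E_x' f <= (e^alpha - 1) E_x' f. Averaging privacy over [th] bounds E_x' f
    by e^alpha times the mixture, which makes the mixture the reference law. *)
Lemma ldp_expectation_diff x x' f : bounded_measurable f ->
  (forall z, 0 <= f z) ->
  \int[P x]_z f z - \int[P x']_z f z
  <= expR alpha * (expR alpha - 1) * mix f.
Proof.
move=> bf f0.
have e0 : 0 <= expR alpha by exact: expR_ge0.
have e1 : 1 <= expR alpha by rewrite (le_trans _ (expR_ge1Dx _))// lerDl.
have H y y' : \int[P y]_z f z <= expR alpha * \int[P y']_z f z.
  by apply: le_expectation_measure => // S mS; exact: ldp.
have : \int[P x']_z f z <= expR alpha * mix f.
  rewrite -[leLHS]mul1r -th1 mulr_suml mulr_sumr; apply: ler_sum => y _.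
  by rewrite mulrCA ler_wpM2l.
have := H x x'; nra.
Qed.

(** The dual form of a chi-square bound: the left side is the squared mean of [h] under the
    perturbed mixture. Centering [h] matters, because the perturbation has total mass zero and only
    sees fluctuations of [h]. *)
Lemma ldp_chi2_step (eta : R) (a b : 'I_d) h : 0 <= eta ->
  bounded_measurable h ->
  (mix h + eta * (\int[P a]_z h z - \int[P b]_z h z)) ^+ 2 <=
  (1 + (eta * (expR alpha * (expR alpha - 1))) ^+ 2) * mix (fun z => h z * h z).
Proof.
move=> eta0 bh; set beta := expR alpha * _; set c := mix h.
have e0 : 0 <= expR alpha by exact: expR_ge0.
have e1 : 1 <= expR alpha by rewrite (le_trans _ (expR_ge1Dx _))// lerDl.
have beta0 : 0 <= beta by apply: mulr_ge0; rewrite ?subr_ge0.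
(* The privacy bound needs nonnegative functions, so it is applied separately to the positive part
   [u] and the negative part [w] of [h - c]; [t] below is the mean of |h - c|. *)
pose u z := Num.max (h z - c) 0; pose w z := Num.max (- 1 * (h z - c)) 0.
have bhc : bounded_measurable (fun z => h z - c).
  by apply: bounded_measurableD => //; exact: bounded_measurable_cst.
have bu : bounded_measurable u by exact: bounded_measurable_max0.
have bw : bounded_measurable w.
  exact/bounded_measurable_max0/bounded_measurableZ.
have u0 z : 0 <= u z by rewrite le_max lexx orbT.
have w0 z : 0 <= w z by rewrite le_max lexx orbT.
have huw z : h z = c + (u z + - 1 * w z).
  by rewrite /u /w; case: (leP (h z - c) 0); case: (leP (- 1 * (h z - c)) 0); lra.
have uw2 z : (u z + w z) * (u z + w z) = h z * h z + (- (2 * c) * h z + c ^+ 2).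
  rewrite /u /w; case: (leP (h z - c) 0); case: (leP (- 1 * (h z - c)) 0) => ? ?; nra.
have Eh x : \int[P x]_z h z = c + (\int[P x]_z u z - \int[P x]_z w z).
  have bNw := bounded_measurableZ (- 1) bw.
  transitivity (\int[P x]_z (c + (u z + - 1 * w z))).
    by congr Rintegral; apply/funext.
  rewrite expectationD//; last exact: bounded_measurableD.
    by rewrite expectationD// expectationZ// expectation_cst mulN1r.
  exact: bounded_measurable_cst.
pose t := mix (fun z => u z + w z).
have t2 : t ^+ 2 <= mix (fun z => h z * h z) - c ^+ 2.
  apply: le_trans (mix_sqr (bounded_measurableD bu bw)) _.
  rewrite (_ : (fun z => _) = (fun z => h z * h z + (- (2 * c) * h z + c ^+ 2))).
    have bch := bounded_measurableZ (- (2 * c)) bh.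
    have bc := bounded_measurable_cst (Z := Z) (c ^+ 2).
    rewrite mixD; [|exact: bounded_measurableM|exact: bounded_measurableD].
    by rewrite mixD// mixZ// mix_cst -/c; lra.
  by apply/funext => z; exact: uw2.
have tE : t = mix u + mix w by rewrite /t mixD.
have t0 : 0 <= t.
  rewrite -(mix_cst 0); apply: le_mix; first exact: bounded_measurable_cst.
    exact: bounded_measurableD.
  by move=> z; rewrite addr_ge0.
set D := _ - _.
have DE : `|D| <= beta * t.
  have uab := ldp_expectation_diff a b bu u0.
  have uba := ldp_expectation_diff b a bu u0.
  have wab := ldp_expectation_diff a b bw w0.
  have wba := ldp_expectation_diff b a bw w0.
  by rewrite /D !Eh tE mulrDr ler_norml; apply/andP; split; rewrite -/beta in uab uba wab wba; lra.
have D2 : (c + eta * D) ^+ 2 <= (`|c| + eta * (beta * t)) ^+ 2.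
  have : `|c + eta * D| <= `|c| + eta * (beta * t).
    rewrite (le_trans (ler_normD _ _))// lerD2l normrM ger0_norm//.
    exact: ler_wpM2l.
  by set B := `|c| + _; rewrite ler_norml => /andP[? ?]; nra.
apply: (le_trans D2).
set m2 := mix _ in t2 *; set k := eta * beta.
(* Cauchy-Schwarz: (|c| + k t)^2 <= (1 + k^2)(c^2 + t^2), with defect (t - k |c|)^2, while c^2 + t^2
   is at most the second moment of [h]. *)
have : (1 + k ^+ 2) * (`|c| ^+ 2 + t ^+ 2) <= (1 + k ^+ 2) * m2.
  apply: ler_wpM2l; first by rewrite addr_ge0 ?sqr_ge0.
  by rewrite real_normK ?num_real//; lra.
apply: le_trans; rewrite -subr_ge0.
rewrite [leRHS](_ : _ = (t - k * `|c|) ^+ 2) ?sqr_ge0//.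
by rewrite /k; ring.
Qed.

End one_step.

(** * The chi-square bound for n interactive views *)

Section iterated_probability.
Context (R : realType) (d : nat) {dZ : measure_display} {Z : measurableType dZ}.
Variable Q : 'I_d -> hist Z -> probability Z R.
Hypothesis mQ : forall x S, measurable S ->
  measurable_fun setT (fun s : hist Z => Q x s S).
Implicit Types (g : hist Z -> R) (th : 'I_d -> R) (s : hist Z).

(** A real-valued version, meaningful for payoffs in [0, 1], where the iterated expectation is
    finite. *)
Definition iterR th g (m : nat) s : R := fine (iterE Q th (EFin \o g) m s).

Definition unit_measurable g :=
  (forall t, 0 <= g t <= 1) /\ measurable_fun setT g.

Lemma iterR_EFin th g m s : simplex th -> unit_measurable g ->
  (iterR th g m s)%:E = iterE Q th (EFin \o g) m s.
Proof.
move=> [th0 th1] [g01 mg].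
have ge0 : (0 <= iterE Q th (EFin \o g) m s)%E.
  by apply: iterE_ge0 => // t; rewrite lee_fin; case/andP: (g01 t).
have le1 : (iterE Q th (EFin \o g) m s <= 1)%E.
  apply: iterE_le1 => //; last exact/measurable_EFinP.
rewrite /iterR fineK// ge0_fin_numE//; apply: le_lt_trans le1 _.
by rewrite ltry.
Qed.

Lemma iterR_ge0 th g m s : simplex th -> unit_measurable g ->
  0 <= iterR th g m s.
Proof.
move=> sth ug; rewrite -lee_fin iterR_EFin//.
by apply: iterE_ge0 => [|t]; [case: sth|rewrite lee_fin; case/andP: (ug.1 t)].
Qed.

Lemma iterR_le1 th g m s : simplex th -> unit_measurable g ->
  iterR th g m s <= 1.
Proof.
move=> sth ug; rewrite -lee_fin iterR_EFin//.
case: sth ug => th0 th1 [g01 mg].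
by apply: iterE_le1 => //; exact/measurable_EFinP.
Qed.

Lemma bounded_measurable_iterR th g m s : simplex th -> unit_measurable g ->
  bounded_measurable (fun z : Z => iterR th g m (rcons s z : hist Z)).
Proof.
move=> sth ug; split; last first.
  by exists 1 => z; rewrite ger0_norm ?iterR_le1 ?iterR_ge0.
apply/measurable_EFinP.
rewrite (_ : _ \o _ = fun z => iterE Q th (EFin \o g) m (rcons s z : hist Z)).
  have [th0 th1] := sth.
  apply: measurable_iterE_rcons => //.
    by move=> t; rewrite lee_fin; case/andP: (ug.1 t).
  by case: ug => _ mg; exact/measurable_EFinP.
by apply/funext => z; rewrite -iterR_EFin.
Qed.

Lemma iterRS th g m s : simplex th -> unit_measurable g ->
  iterR th g m.+1 s =
  mix (fun x => Q x s) th (fun z => iterR th g m (rcons s z : hist Z)).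
Proof.
move=> sth ug; apply: EFin_inj; rewrite iterR_EFin//= /mix -sumEFin.
apply: eq_bigr => x _; rewrite EFinM expectationE; last first.
  exact: bounded_measurable_iterR.
by congr (_ * _)%E; apply: eq_integral => z _; rewrite iterR_EFin.
Qed.

Variable alpha : R.
Hypothesis alpha0 : 0 <= alpha.
Hypothesis ldp : forall x x' s S, measurable S ->
  (Q x s S <= (expR alpha)%:E * Q x' s S)%E.

(** Induction on the number of views left. The one-step bound is applied to the conditional
    expectation under [th'] as a function of the next view, and the induction hypothesis then bounds
    its square pointwise. The factors multiply because each is uniform in the history. *)
Lemma iterR_chi2 th th' (a b : 'I_d) (eta : R) g m s :
  0 <= eta -> simplex th -> simplex th' ->
  (forall x, th' x = th x + eta * ((x == a)%:R - (x == b)%:R)) ->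
  unit_measurable g ->
  iterR th' g m s ^+ 2 <=
  (1 + (eta * (expR alpha * (expR alpha - 1))) ^+ 2) ^+ m * iterR th g m s.
Proof.
move=> eta0 sth sth' thE ug; set K := 1 + _.
have K0 : 0 <= K by rewrite addr_ge0// sqr_ge0.
elim: m s => [|m IH] s.
  (* With no view left the claim is g^2 <= g, which holds because [g] takes values in [0, 1]. *)
  by rewrite mul1r /iterR /=; have := ug.1 s; nra.
rewrite !iterRS//.
set h := fun z : Z => iterR th' g m (rcons s z : hist Z).
have bh : bounded_measurable h by exact: bounded_measurable_iterR.
have b0 := bounded_measurable_iterR m s sth ug.
have [th0 th1] := sth.
have -> : mix (Q^~ s) th' h =
    mix (Q^~ s) th h + eta * (\int[Q a s]_z h z - \int[Q b s]_z h z).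
  rewrite /mix; under eq_bigr do rewrite thE mulrDl.
  rewrite big_split/=; congr (_ + _).
  under eq_bigr do rewrite -mulrA.
  rewrite -mulr_sumr; congr (_ * _).
  under eq_bigr do rewrite mulrBl.
  rewrite sumrB; congr (_ - _).
  - by rewrite (bigD1 a)//= eqxx mul1r big1 ?addr0// => x /negPf ->; rewrite mul0r.
  - by rewrite (bigD1 b)//= eqxx mul1r big1 ?addr0// => x /negPf ->; rewrite mul0r.
apply: le_trans (ldp_chi2_step alpha0 _ th0 th1 _ _ eta0 bh) _.
  by move=> x x' S mS; exact: ldp.
rewrite -/K [in leRHS]exprS -[leRHS]mulrA; apply: ler_wpM2l => //.
rewrite -(@mixZ _ _ _ _ (Q^~ s) th (K ^+ m) _ b0).
apply: le_mix => //; first exact: bounded_measurableM.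
  exact: bounded_measurableZ.
by move=> z; rewrite -expr2; exact: IH.
Qed.

End iterated_probability.

(** * Averaging over one block *)

Section block_update.
Context (k m : nat).
Implicit Types (v : {ffun 'I_k -> 'I_m}) (b : 'I_k) (u : 'I_m).

Definition update v b u : {ffun 'I_k -> 'I_m} :=
  [ffun i => if i == b then u else v i].

(* The swap (v, u) |-> (v[b := u], v b) is an involution. *)
Lemma sum_update (R : realType) b u0 (F : {ffun 'I_k -> 'I_m} -> 'I_m -> R) :
  (forall v, \sum_(u < m) F v u <= 1) ->
  m%:R * \sum_v F (update v b u0) (v b) <= #|{ffun 'I_k -> 'I_m}|%:R.
Proof.
move=> F1.
have -> : m%:R * \sum_v F (update v b u0) (v b) =
    \sum_v \sum_(u < m) F (update v b u0) u.
  rewrite mulr_sumr.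
  under eq_bigr do rewrite mulr_natl -[X in _ *+ X]card_ord -sumr_const.
  rewrite !pair_big/=.
  pose swap (p : {ffun 'I_k -> 'I_m} * 'I_m) := (update p.1 b p.2, p.1 b).
  have swapK : involutive swap.
    move=> [v u]; rewrite /swap/= ffunE eqxx; congr pair.
    by apply/ffunP => i; rewrite !ffunE; case: eqP => [->|].
  rewrite (reindex_inj (inv_inj swapK))/=; apply: eq_bigr => -[v u] _ /=.
  rewrite ffunE eqxx; congr F.
  by apply/ffunP => i; rewrite !ffunE; case: eqP.
apply: (@le_trans _ _ (\sum_(v : {ffun 'I_k -> 'I_m}) 1)); last by rewrite sumr_const.
exact: ler_sum.
Qed.

End block_update.

(** * The block construction and its risk *)

Section packing.
Context (R : realType) (d n k m : nat) {dZ : measure_display} {Z : measurableType dZ}.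
Variable Q : 'I_d -> hist Z -> probability Z R.
Variables (alpha : R) (est : hist Z -> 'I_d -> R).
Hypothesis alpha0 : 0 <= alpha.
Hypothesis Qldp : is_LDP_channel alpha Q.
Hypothesis mest : is_estimator est.
Variables (x0 : 'I_d) (u0 : 'I_m) (J : 'I_k -> 'I_m -> 'I_d).
Hypothesis J_inj : forall b b' u u', J b u = J b' u' -> b = b' /\ u = u'.
Variable eta : R.
Hypothesis eta0 : 0 <= eta.
Hypothesis keta : k%:R * eta <= 1.
Implicit Types (v : {ffun 'I_k -> 'I_m}) (b : 'I_k) (u : 'I_m) (s : hist Z).

(** The leftover mass sits on [x0], which may itself be a block coordinate. It does not depend on
    [v], so [block_loss] simply subtracts it. *)
Definition base_mass (x : 'I_d) : R := (1 - k%:R * eta) * (x == x0)%:R.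

Definition packing_point v (x : 'I_d) : R :=
  base_mass x + eta * \sum_(b < k) (x == J b (v b))%:R.

Lemma sum_indicator (y : 'I_d) : \sum_(x < d) (x == y)%:R = 1 :> R.
Proof.
by rewrite (bigD1 y)//= eqxx big1 ?addr0// => x /negPf ->.
Qed.

Lemma simplex_packing_point v : simplex (packing_point v).
Proof.
split=> [x|].
  by rewrite addr_ge0// mulr_ge0// ?subr_ge0// sumr_ge0.
rewrite big_split/= -mulr_sumr sum_indicator mulr1 -mulr_sumr exchange_big/=.
under eq_bigr do rewrite sum_indicator.
by rewrite sumr_const card_ord [eta * _]mulrC subrK.
Qed.

Lemma packing_point_block v b u :
  packing_point v (J b u) = base_mass (J b u) + eta * (u == v b)%:R.
Proof.
congr (_ + _ * _); rewrite (bigD1 b)//= big1 ?addr0.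
  by congr (_%:R); congr nat_of_bool; apply/eqP/eqP => [/J_inj[]|->].
by move=> b' bb'; case: eqP => // /J_inj[eb _]; rewrite eb eqxx in bb'.
Qed.

Lemma packing_point_update v b x : packing_point v x =
  packing_point (update v b u0) x +
  eta * ((x == J b (v b))%:R - (x == J b u0)%:R).
Proof.
rewrite /packing_point -addrA -mulrDr; congr (_ + _ * _).
rewrite (bigD1 b)//= [in RHS](bigD1 b)//= ffunE eqxx.
rewrite [in RHS](eq_bigr (fun i => (x == J i (v i))%:R)); first by ring.
by move=> i /negPf ib; rewrite ffunE ib.
Qed.

Definition block_loss b u s : R :=
  \sum_(w < m) (est s (J b w) - base_mass (J b w) - eta * (w == u)%:R) ^+ 2.

Definition block_hit b u s : R := (block_loss b u s < eta ^+ 2 / 2)%R%:R.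

Lemma block_loss_ge0 b u s : 0 <= block_loss b u s.
Proof. by apply: sumr_ge0 => w _; exact: sqr_ge0. Qed.

(** Injectivity of [J] makes the blocks disjoint, and coordinates outside all blocks only add to the
    loss. *)
Lemma sum_block_loss v s :
  \sum_(b < k) block_loss b (v b) s <= sqloss (est s) (packing_point v).
Proof.
have -> : \sum_(b < k) block_loss b (v b) s =
    \sum_(x in [set J p.1 p.2 | p in [set: 'I_k * 'I_m]]%SET)
       (est s x - packing_point v x) ^+ 2.
  rewrite big_imset/=; last first.
    by move=> [b u] [b' u'] _ _ /= /J_inj[-> ->].
  rewrite /block_loss pair_big/=; apply: eq_big => [p|p _]; first by rewrite inE.
  by rewrite packing_point_block opprD addrA.
rewrite /sqloss [leRHS](bigID (mem [set J p.1 p.2 | p in [set: 'I_k * 'I_m]]%SET))/=.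
by rewrite lerDl sumr_ge0// => x _; exact: sqr_ge0.
Qed.

(** Two values of [u] cannot both be hit: the targets of a block are at squared distance 2 eta^2,
    which forces the two losses to add up to at least eta^2. *)
Lemma sum_block_hit b s : \sum_(u < m) block_hit b u s <= 1.
Proof.
have hit u : block_hit b u s = 0 \/ block_loss b u s < eta ^+ 2 / 2.
  by rewrite /block_hit; case: ltP => _; [right|left].
case: (pickP (fun u => block_loss b u s < eta ^+ 2 / 2)) => [u hu|none]; last first.
  by rewrite big1// => u _; rewrite /block_hit none.
rewrite (bigD1 u)//= [X in _ + X]big1 ?addr0.
  by rewrite /block_hit hu.
move=> u' u'u; have [//|hu'] := hit u'.
suff : eta ^+ 2 <= block_loss b u s + block_loss b u' s by lra.
rewrite /block_loss -big_split/= (bigD1 u)//= (bigD1 u')//= addrA.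
rewrite eqxx (negPf u'u) eq_sym (negPf u'u) eqxx.
set r := \sum_(i < m | _) _.
have r0 : 0 <= r by apply: sumr_ge0 => w _; rewrite addr_ge0 ?sqr_ge0.
(* At each of the coordinates [u] and [u'], p^2 + (p - eta)^2 = ((2p - eta)^2 + eta^2) / 2 >= eta^2
   / 2. *)
set p := est s (J b u) - _; set q := est s (J b u') - _.
have := sqr_ge0 (2 * p - eta); have := sqr_ge0 (2 * q - eta).
rewrite /= !mulr1 !mulr0 !subr0.
by nra.
Qed.

Lemma unit_measurable_block_hit b u : unit_measurable (block_hit b u).
Proof.
split=> [s|]; first by rewrite ler0n/= lern1 leq_b1.
have mb : measurable_fun setT (block_loss b u).
  apply: measurable_sum => w; apply: measurable_funX.
  by apply: measurable_funB => //; apply: measurable_funB => //; exact: (mest (J b w)).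
apply: (measurableT_comp (f := fun c : bool => c%:R : R)) => //.
exact: measurable_fun_ltr.
Qed.

Lemma sum_iterR_block_hit th b s : simplex th ->
  \sum_(u < m) iterR Q th (block_hit b u) n s <= 1.
Proof.
move=> sth; have [mQ _] := Qldp; have [th0 th1] := sth.
have uh u := unit_measurable_block_hit b u.
rewrite -lee_fin -sumEFin.
under eq_bigr do rewrite iterR_EFin//.
rewrite -(iterE_sum mQ th0); first last.
- by move=> u; apply/measurable_EFinP; case: (uh u).
- by move=> u t; rewrite lee_fin; case: (uh u) => /(_ t)/andP[].
apply: iterE_le1 => //.
- by move=> t; rewrite sumEFin !lee_fin sum_block_hit andbT sumr_ge0.
- by apply: emeasurable_sum => u; apply/measurable_EFinP; case: (uh u).
Qed.

Let K := (1 + (eta * (expR alpha * (expR alpha - 1))) ^+ 2) ^+ n.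

(** Linearizes the chi-square comparison by p <= (1 + p^2) / 2, so that it can be averaged over
    [v]. *)
Lemma iterR_block_hit v b s :
  iterR Q (packing_point v) (block_hit b (v b)) n s <=
  (1 + K * iterR Q (packing_point (update v b u0)) (block_hit b (v b)) n s) / 2.
Proof.
have [mQ ldp] := Qldp.
have := iterR_chi2 mQ alpha0 ldp n s eta0
  (simplex_packing_point (update v b u0)) (simplex_packing_point v)
  (packing_point_update v b) (unit_measurable_block_hit b (v b)).
rewrite -/K; set p := iterR _ (packing_point v) _ _ _; set q := iterR _ _ _ _ _.
by have := sqr_ge0 (p - 1); lra.
Qed.

(** For each block, [sum_update] turns the average over [v] into hits of distinct values under one
    common law. These have total probability at most 1, whence the factor 1/m. *)
Lemma sum_iterR_block_hit_packing s : (0 < m)%N ->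
  \sum_v \sum_(b < k) iterR Q (packing_point v) (block_hit b (v b)) n s <=
  #|{ffun 'I_k -> 'I_m}|%:R * (k%:R * (1 + K / m%:R) / 2).
Proof.
move=> m0; set N := #|_|%:R.
have m0' : 0 < m%:R :> R by rewrite ltr0n.
have K0 : 0 <= K by rewrite exprn_ge0// addr_ge0// sqr_ge0.
rewrite exchange_big/=.
apply: (@le_trans _ _ (\sum_(b < k) (N * ((1 + K / m%:R) / 2)))); last first.
  by rewrite sumr_const card_ord -mulr_natl; lra.
apply: ler_sum => b _.
apply: le_trans (ler_sum _ (fun v _ => iterR_block_hit v b s)) _.
rewrite -mulr_suml big_split/= sumr_const -mulr_sumr mulrA -/N.
apply: ler_wpM2r => //; rewrite mulrDr mulr1 lerD2l.
rewrite [leRHS]mulrCA; apply: ler_wpM2l => //.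
rewrite ler_pdivlMr// mulrC.
apply: (sum_update b u0
  (F := fun w u => iterR Q (packing_point w) (block_hit b u) n s)) => w.
exact: sum_iterR_block_hit (simplex_packing_point w).
Qed.

(** Every missed block costs at least eta^2 / 2. The hits are added to the risk rather than
    subtracted from the bound, which keeps all payoffs nonnegative. *)
Lemma risk_packing_point v :
  ((k%:R * (eta ^+ 2 / 2))%:E <= risk n Q est (packing_point v) +
   (eta ^+ 2 / 2 * \sum_(b < k)
      iterR Q (packing_point v) (block_hit b (v b)) n [::])%:E)%E.
Proof.
have [mQ _] := Qldp.
have e0 : 0 <= eta ^+ 2 / 2 by rewrite divr_ge0// sqr_ge0.
have sv := simplex_packing_point v; have [th0 th1] := sv.
have uh b := unit_measurable_block_hit b (v b).
have mh b : measurable_fun setT (EFin \o block_hit b (v b)).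
  by apply/measurable_EFinP; case: (uh b).
have h0 b t : (0 <= (EFin \o block_hit b (v b)) t)%E.
  by rewrite lee_fin; case: (uh b) => /(_ t)/andP[].
rewrite [X in (_ + X)%E]EFinM -sumEFin; under eq_bigr do rewrite iterR_EFin//.
rewrite -(iterE_sum mQ th0)// -(iterEZ mQ th0)//; first last.
- exact: emeasurable_sum.
- by move=> t; apply: sume_ge0.
rewrite /risk risk_fromE -(iterED mQ th0)//; first last.
- by apply: measurable_funeM; exact: emeasurable_sum.
- apply/measurable_EFinP; apply: measurable_sum => j; apply: measurable_funX.
  by apply: measurable_funB => //; exact: (mest j).
- by move=> t; apply: mule_ge0 => //; apply: sume_ge0.
- by move=> t; rewrite lee_fin; apply: sumr_ge0 => j _; exact: sqr_ge0.
rewrite -(iterE_cst Q th1 (k%:R * (eta ^+ 2 / 2)) n [::]).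
apply: (le_iterE mQ) => //.
- by move=> t; rewrite lee_fin mulr_ge0.
- apply: emeasurable_funD.
    apply/measurable_EFinP; apply: measurable_sum => j; apply: measurable_funX.
    by apply: measurable_funB => //; exact: (mest j).
  by apply: measurable_funeM; exact: emeasurable_sum.
move=> t /=; rewrite sumEFin -EFinM -EFinD lee_fin.
apply: (@le_trans _ _ (\sum_(b < k) (block_loss b (v b) t +
    eta ^+ 2 / 2 * block_hit b (v b) t))); last first.
  by rewrite big_split/= -mulr_sumr lerD2r sum_block_loss.
rewrite -[X in X%:R]card_ord mulr_natl -sumr_const; apply: ler_sum => b _.
rewrite /block_hit; case: ltP => h; rewrite ?mulr1 ?mulr0 ?addr0//.
by rewrite lerDr block_loss_ge0.
Qed.

Lemma sup_risk_packing : (0 < m)%N -> K <= 3 / 4 * m%:R ->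
  ((k%:R * eta ^+ 2 / 16)%:E <=
   ereal_sup [set risk n Q est th | th in @simplex R d])%E.
Proof.
move=> m0 Km; rewrite leNgt; apply/negP => lt_sup.
have m0' : 0 < m%:R :> R by rewrite ltr0n.
have e0 : 0 <= eta ^+ 2 / 2 by rewrite divr_ge0// sqr_ge0.
(* If every risk were below k eta^2 / 16, each [v] would have expected hits whose eta^2 / 2 multiple
   exceeds 7 k eta^2 / 16. On average there are at most k (1 + 3/4) / 2 = 7k/8 hits, a
   contradiction. *)
have small v : k%:R * (eta ^+ 2 / 2) - k%:R * eta ^+ 2 / 16 <
    eta ^+ 2 / 2 * \sum_(b < k)
      iterR Q (packing_point v) (block_hit b (v b)) n [::].
  have : (risk n Q est (packing_point v) < (k%:R * eta ^+ 2 / 16)%:E)%E.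
    apply: le_lt_trans lt_sup; apply: ereal_sup_ubound.
    by exists (packing_point v) => //; exact: simplex_packing_point.
  have := risk_packing_point v; case: (risk _ _ _ _) => [r| |]//=.
  by rewrite -EFinD lee_fin lte_fin; lra.
have := sum_iterR_block_hit_packing [::] m0; set N := #|_|%:R.
set S := \sum_v _ => SN.
have N0 : 0 < N.
  by rewrite ltr0n; apply/card_gt0P; exists [ffun=> u0].
have : \sum_(v : {ffun 'I_k -> 'I_m})
    (k%:R * (eta ^+ 2 / 2) - k%:R * eta ^+ 2 / 16) < eta ^+ 2 / 2 * S.
  rewrite mulr_sumr; apply: ltr_sum => [|v _]; last exact: small.
  by apply/hasP; exists [ffun=> u0]; rewrite ?mem_index_enum.
rewrite sumr_const -mulr_natl -/N.
have Km' : K / m%:R <= 3 / 4 by rewrite ler_pdivrMr.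
have k0 : 0 <= k%:R :> R by [].
have : eta ^+ 2 / 2 * S <= eta ^+ 2 / 2 * (N * (k%:R * (7 / 8))).
  apply: ler_wpM2l => //; apply: (le_trans SN); apply: ler_wpM2l; first exact: ltW.
  by rewrite -mulrA; apply: ler_wpM2l => //; lra.
lra.
Qed.

End packing.

(** * Choice of parameters and the lower rate *)

Section lower_bound.
Context (R : realType).

Lemma sup_risk_blocks (d n k m : nat) {dZ : measure_display}
    {Z : measurableType dZ} (Q : 'I_d -> hist Z -> probability Z R)
    (alpha eta : R) (est : hist Z -> 'I_d -> R) :
  0 <= alpha -> is_LDP_channel alpha Q -> is_estimator est ->
  (0 < k)%N -> (0 < m)%N -> (k * m <= d)%N ->
  0 <= eta -> k%:R * eta <= 1 ->
  (1 + (eta * (expR alpha * (expR alpha - 1))) ^+ 2) ^+ n <= 3 / 4 * m%:R ->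
  ((k%:R * eta ^+ 2 / 16)%:E <=
   ereal_sup [set risk n Q est th | th in @simplex R d])%E.
Proof.
move=> alpha0 Qldp mest k0 m0 kmd eta0 keta Km.
have d0 : (0 < d)%N by apply: leq_trans kmd; rewrite muln_gt0 k0.
have Jlt (b : 'I_k) (u : 'I_m) : (b * m + u < d)%N.
  apply: (@leq_trans (b * m + m)); first by rewrite ltn_add2l.
  by rewrite addnC -mulSn (leq_trans _ kmd)// leq_mul2r ltn_ord orbT.
(* Consecutive intervals of length [m]; quotient and remainder by [m] recover block and position. *)
pose J b u := Ordinal (Jlt b u).
apply: (@sup_risk_packing R d n k m _ Z Q alpha est alpha0 Qldp mest
  (Ordinal d0) (Ordinal m0) J) => //.
move=> b b' u u' [bu]; split; apply: val_inj => /=.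
  by rewrite -[LHS]addn0 -(divn_small (ltn_ord u)) -divnMDl// bu divnMDl//
    (divn_small (ltn_ord u')) addn0.
by rewrite -[LHS](modn_small (ltn_ord u)) -(modnMDl b) bu modnMDl modn_small.
Qed.

(** From e^alpha (1 - alpha) <= 1 one gets e^alpha - 1 <= alpha e^alpha and, as alpha <= 1/4,
    e^alpha <= 4/3. The product is then at most 16/9 alpha. *)
Lemma expR_sub1_bound (alpha : R) : 0 <= alpha <= 4^-1 ->
  0 <= expR alpha * (expR alpha - 1) <= 2 * alpha.
Proof.
move=> /andP[a0 a1].
have e1 : 1 <= expR alpha by rewrite (le_trans _ (expR_ge1Dx _))// lerDl.
have : expR alpha * (1 - alpha) <= 1.
  rewrite -[leRHS](expRxMexpNx_1 alpha); apply: ler_wpM2l; first exact: expR_ge0.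
  exact: expR_ge1Dx.
set E := expR alpha in e1 *; move=> Ea.
have E43 : E <= 4 / 3 by nra.
have E2 : E * E <= 16 / 9 by nra.
by apply/andP; split; nra.
Qed.

Lemma likelihood_growth_bound (alpha eta L : R) (n m : nat) :
  (2 <= m)%N -> 0 <= alpha <= 4^-1 ->
  expR L <= m.+1%:R -> 16 * n%:R * alpha ^+ 2 * eta ^+ 2 <= L ->
  (1 + (eta * (expR alpha * (expR alpha - 1))) ^+ 2) ^+ n <= 3 / 4 * m%:R.
Proof.
move=> m2 a01 Lm etaL; have /andP[] := expR_sub1_bound a01.
set beta := expR alpha * _ => b0 b2.
have a0 : 0 <= alpha by case/andP: a01.
set x := (eta * beta) ^+ 2; have x0 : 0 <= x by exact: sqr_ge0.
have m2' : 2 <= m%:R :> R by rewrite ler_nat.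
have n0 : 0 <= n%:R :> R by [].
have nx : 4 * (n%:R * x) <= L.
  have : x <= 4 * (alpha ^+ 2 * eta ^+ 2).
    rewrite /x exprMn mulrC mulrA; apply: ler_wpM2r; first exact: sqr_ge0.
    by nra.
  by nra.
have Kexp : (1 + x) ^+ n <= expR (n%:R * x).
  by rewrite expRM_natl lerXn2r ?nnegrE ?expR_ge0 ?addr_ge0// expR_ge1Dx.
apply: (le_trans Kexp).
have m0 : 0 <= 3 / 4 * m%:R :> R by lra.
(* Fourth powers turn exp(n x) into exp(4 n x) <= exp(L) <= m + 1, and m + 1 <= (3m/4)^4 as soon as
   m >= 2. *)
rewrite -(@ler_pXn2r _ 4) ?nnegrE ?expR_ge0//.
rewrite -expRM_natl.
apply: (@le_trans _ _ (expR L)); first by rewrite ler_expR.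
apply: (le_trans Lm); rewrite -natr1.
set y : R := m%:R in m2' *.
have y2 : 4 <= y ^+ 2 by nra.
have -> : (3 / 4 * y) ^+ 4 = 81 / 256 * (y ^+ 2 * y ^+ 2) by field.
by nra.
Qed.

Lemma sup_risk_ge0 (d n : nat) {dZ : measure_display} {Z : measurableType dZ}
    (Q : 'I_d -> hist Z -> probability Z R) (est : hist Z -> 'I_d -> R) :
  (0 < d)%N ->
  (0 <= ereal_sup [set risk n Q est th | th in @simplex R d])%E.
Proof.
move=> d0; pose th (x : 'I_d) : R := (x == Ordinal d0)%:R.
have th0 x : 0 <= th x by [].
apply: (@le_trans _ _ (risk n Q est th)).
  rewrite /risk risk_fromE; apply: iterE_ge0 => // t.
  by rewrite lee_fin; apply: sumr_ge0 => j _; exact: sqr_ge0.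
apply: ereal_sup_ubound; exists th => //; split=> //.
exact: sum_indicator.
Qed.

(* A sparsity level k close to d leaves blocks of size 1; half of k always
   leaves blocks of size at least 2. *)
Lemma halved_sparsity (d k : nat) : (2 <= d)%N -> (0 < k <= d)%N ->
  exists k' m, [/\ (0 < k')%N, (k' <= k <= 3 * k')%N, (2 <= m)%N,
    (k' * m <= d)%N & (d <= k' * m.+1)%N].
Proof.
move=> d2 /andP[k0 kd]; exists (maxn 1 (k %/ 2)), (d %/ maxn 1 (k %/ 2))%N.
set k' := maxn 1 (k %/ 2); have k'0 : (0 < k')%N by rewrite leq_max.
have k'd : (2 * k' <= d)%N.
  rewrite /k'; case: (leqP 1 (k %/ 2)) => _ //.
  by rewrite mulnC (leq_trans (leq_trunc_div _ _)).
split => //.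
- have kE := divn_eq k 2; have := ltn_pmod k (isT : (0 < 2)%N).
  by rewrite /k'; case: (leqP 1 (k %/ 2)) => ? ?; apply/andP; split; lia.
- by rewrite leq_divRL.
- by rewrite mulnC leq_trunc_div.
- by rewrite mulnC ltnW// ltn_ceil.
Qed.

Lemma sup_risk_rate (c : R) (d n k : nat) {dZ : measure_display} {Z : measurableType dZ}
    (Q : 'I_d -> hist Z -> probability Z R) (alpha : R)
    (est : hist Z -> 'I_d -> R) :
  0 < c <= 32^-1 ^+ 2 -> (0 < n)%N -> 0 <= alpha <= 4^-1 ->
  is_LDP_channel alpha Q -> is_estimator est -> (0 < k <= d)%N ->
  (c%:E * Order.min (k%:R^-1)%:E
     (ediv (k%:R * ln (d%:R / k%:R)) (n%:R * alpha ^+ 2)) <=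
   ereal_sup [set risk n Q est th | th in @simplex R d])%E.
Proof.
move=> /andP[c0 c1] n0 a01 Qldp mest kd; have /andP[a0 _] := a01.
(* For [d = 1] also [k = 1], so the logarithm and hence the rate vanish, even at [alpha = 0] since
   0/0 is read as 0. *)
have [d1|d2] := leqP d 1.
  have d0 : (0 < d)%N by case/andP: kd; exact: leq_trans.
  apply: le_trans (sup_risk_ge0 _ _ _ d0).
  have -> : k = 1%N by case/andP: kd => k0 kd; apply/eqP; rewrite eqn_leq k0 (leq_trans kd).
  have -> : d = 1%N by apply/eqP; rewrite eqn_leq d0 d1.
  by rewrite divr1 ln1 mulr0 /ediv mul0e min_r ?mule0// lee_fin invr_ge0.
have [k0 kled] := andP kd.
have [k' [m [k'0 /andP[k'k kk'] m2 k'm dk']]] := halved_sparsity d2 kd.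
have kR : 0 < k%:R :> R by rewrite ltr0n.
have k'R : 0 < k'%:R :> R by rewrite ltr0n.
have dR : 0 < d%:R :> R by rewrite ltr0n (leq_trans k0).
have nR : 0 < n%:R :> R by rewrite ltr0n.
set L := ln (d%:R / k%:R).
have L0 : 0 <= L by rewrite ln_ge0// ler_pdivlMr// mul1r ler_nat.
have Lm : expR L <= m.+1%:R.
  rewrite lnK ?posrE ?divr_gt0// ler_pdivrMr// -natrM ler_nat.
  by rewrite (leq_trans dk')// mulnC leq_mul2l k'k orbT.
have k'kR : k'%:R <= k%:R :> R by rewrite ler_nat.
have kk'R : k%:R <= 3 * k'%:R :> R by rewrite -natrM ler_nat.
have bound eta := sup_risk_blocks (n := n) (eta := eta) a0 Qldp mest k'0 (ltnW m2) k'm.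
(* At [alpha = 0] the views carry no information, the growth condition holds for every [eta], and
   the largest admissible value 1/k' is used. *)
have [aE|a_neq0] := eqVneq alpha 0.
  have := bound k'%:R^-1; rewrite mulfV ?gt_eqF// invr_ge0 ler0n => /(_ isT (lexx _)).
  have -> : k'%:R * k'%:R^-1 ^+ 2 / 16 = k'%:R^-1 / 16 :> R.
    by field; rewrite gt_eqF.
  move=> H; apply: le_trans (H _); last first.
    by apply: likelihood_growth_bound Lm _ => //; rewrite aE; lra.
  apply: (@le_trans _ _ (c%:E * (k%:R^-1)%:E)%E).
    by apply: lee_wpmul2l; [rewrite lee_fin ltW|rewrite ge_min lexx].
  rewrite -EFinM lee_fin.
  have : k%:R^-1 <= k'%:R^-1 :> R by rewrite lef_pV2.
  have : 0 <= k%:R^-1 :> R by rewrite invr_ge0.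
  by move: c0 c1; set x := k%:R^-1; set y := k'%:R^-1; nra.
have apos : 0 < alpha by rewrite lt_neqAle eq_sym a_neq0.
have a2 : 0 < n%:R * alpha ^+ 2 by rewrite mulr_gt0// exprn_gt0.
(* The square of [eta]: the first term enforces [k' * eta <= 1], the second the hypothesis of
   [likelihood_growth_bound]. *)
pose e2 : R := Num.min (k'%:R^-1 ^+ 2) (L / (16 * (n%:R * alpha ^+ 2))).
have e20 : 0 <= e2.
  rewrite le_min exprn_ge0 ?invr_ge0//= divr_ge0// mulr_ge0//.
  exact: ltW.
have := bound (Num.sqrt e2); rewrite sqrtr_ge0 => /(_ isT).
rewrite sqr_sqrtr// => H.
have e2k : e2 <= k'%:R^-1 ^+ 2 by rewrite ge_min lexx.
have e2L : e2 <= L / (16 * (n%:R * alpha ^+ 2)) by rewrite ge_min lexx orbT.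
apply: le_trans (H _ _); first last.
- apply: likelihood_growth_bound Lm _ => //; rewrite sqr_sqrtr//.
  by move: e2L; rewrite ler_pdivlMr ?mulr_gt0//; lra.
- rewrite mulrC -ler_pdivlMr// div1r.
  rewrite (_ : k'%:R^-1 = Num.sqrt (k'%:R^-1 ^+ 2)); first exact: ler_wsqrtr.
  by rewrite sqrtr_sqr ger0_norm ?invr_ge0.
rewrite /ediv inver gt_eqF// -EFinM -/L -EFin_min -EFinM lee_fin.
set A := n%:R * alpha ^+ 2 in a2 *.
have k'V : k%:R^-1 <= k'%:R^-1 :> R by rewrite lef_pV2.
have kV0 : 0 <= k%:R^-1 :> R by rewrite invr_ge0.
have LA0 : 0 <= L / A by rewrite divr_ge0// ltW.
have kLA : k%:R * (L / A) <= 3 * k'%:R * (L / A) by exact: ler_wpM2r.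
have k'LA0 : 0 <= k'%:R * (L / A) by rewrite mulr_ge0.
rewrite /e2 -/A; case: (leP (k'%:R^-1 ^+ 2) (L / (16 * A))) => _.
  have -> : k'%:R * k'%:R^-1 ^+ 2 / 16 = k'%:R^-1 / 16 :> R.
    by field; rewrite gt_eqF.
  apply: (@le_trans _ _ (c * k%:R^-1)); last first.
    by rewrite [leRHS]mulrC; apply: ler_pM => //; [exact: ltW|lra].
  by apply: ler_wpM2l; [exact: ltW|rewrite ge_min lexx].
have -> : k'%:R * (L / (16 * A)) / 16 = k'%:R * (L / A) / 256.
  by field; rewrite gt_eqF.
apply: (@le_trans _ _ (c * (k%:R * L / A))).
  by apply: ler_wpM2l; [exact: ltW|rewrite ge_min lexx orbT].
rewrite -mulrA; move: kLA k'LA0 LA0; rewrite -mulrA.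
set x := k%:R * _; set y := k'%:R * _ => ? ? ?.
(* Passing from [k] to [k'] costs a factor 3, and 3 / 32^2 <= 1 / 256. *)
apply: (@le_trans _ _ (c * (3 * y))); first by rewrite ler_wpM2l// ltW.
by nra.
Qed.

Lemma private_minimax_ge (c : R) (d n : nat) (alpha : R) :
  0 < c <= 32^-1 ^+ 2 -> (0 < n)%N -> 0 <= alpha <= 4^-1 ->
  (c%:E * lower_rate d n alpha <= private_minimax d n alpha)%E.
Proof.
move=> c01 n0 a01; have /andP[c0 _] := c01; apply: le_ereal_inf_tmp => _ [dZ [Z [Q [est [Qldp [mest ->]]]]]].
rewrite /lower_rate; elim/big_ind: _ => [|x y hx hy|k _].
- by rewrite gt0_muleNy ?leNye.
- by rewrite /Order.max; case: ifP.
- by apply: (sup_risk_rate (k := k.+1)) => //=.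
Qed.

End lower_bound.

(** * Discrete views and finitely supported laws *)

Lemma measurable_hist_nat (A : set (hist nat)) : measurable A.
Proof.
(* There are countably many histories of integers, and each singleton is a rectangle of
   singletons. *)
apply: countable_measurable => [s|]; last exact: (countableP (A : set (seq nat))).
rewrite (_ : [set s] = [set t | in_rect [seq [set z] | z <- s] t]).
  by apply: measurable_rect; elim: (s : seq nat).
apply/seteqP; split=> [t ->|t].
  by rewrite /=; elim: (s : seq nat).
rewrite /=; elim: (s : seq nat) (t : seq nat) => [|z s' IH] [|y t'] //=.
by move=> [-> /IH ->].
Qed.

Section finite_law.
Context (R : realType) (N : nat) (w : nat -> {nonneg R}).

(** The normalization is an argument so that the probability structure can be attached to the law
    itself. *)
Definition finite_law of \sum_(i < N) (w i)%:num = 1 : set nat -> \bar R :=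
  msum (fun i => mscale (w i) \d_i) N.

Hypothesis w1 : \sum_(i < N) (w i)%:num = 1.

HB.instance Definition _ := Measure.on (finite_law w1).

Lemma finite_law_setT : finite_law w1 setT = 1%E.
Proof.
rewrite -w1 -sumEFin; apply: eq_bigr => i _.
by rewrite -[LHS]/((w i)%:num%:E * \d_(nat_of_ord i) setT)%E diracT mule1.
Qed.

HB.instance Definition _ := Measure_isProbability.Build _ _ R (finite_law w1) finite_law_setT.

Lemma integral_finite_law (f : nat -> R) : (forall i, 0 <= f i) ->
  (\int[finite_law w1]_i (f i)%:E = (\sum_(i < N) (w i)%:num * f i)%:E)%E.
Proof.
move=> f0; rewrite ge0_integral_measure_sum//=; last by move=> i _; rewrite lee_fin.
rewrite -sumEFin; apply: eq_bigr => i _.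
rewrite ge0_integral_mscale//=; last by move=> j _; rewrite lee_fin.
by rewrite integral_dirac//= diracT mul1e.
Qed.

End finite_law.

(** * Sign vectors coded by integers *)

Section sign_code.
Context (R : realType) (d : nat).
Notation signs := {ffun 'I_d -> bool}.

(** Integers beyond the enumeration decode to the all-plus vector, so the value is a sign for every
    [i]. *)
Definition sign_of (j : 'I_d) (i : nat) : R :=
  (-1) ^+ nth [ffun=> false] (enum {: signs}) i j.

Lemma sign_of_sqr j i : sign_of j i ^+ 2 = 1.
Proof. exact: sqrr_sign. Qed.

Lemma sum_signs (F : signs -> R) :
  \sum_(i < #|{: signs}|) F (nth [ffun=> false] (enum {: signs}) i) = \sum_v F v.
Proof.
transitivity (\sum_(v <- enum {: signs}) F v); last by rewrite big_enum.
by rewrite (big_nth [ffun=> false]) big_mkord cardE.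
Qed.

(** Flipping coordinate [j] is an involution of the sign vectors, so the sum equals its own
    opposite. *)
Lemma sum_signs_odd (j : 'I_d) (F : signs -> R) :
  (forall v : signs, F [ffun i => (i == j) (+) v i] = - F v) -> \sum_v F v = 0.
Proof.
move=> Fodd; pose flip (v : signs) : signs := [ffun i => (i == j) (+) v i].
have flipK : involutive flip by move=> v; apply/ffunP => i; rewrite !ffunE addKb.
have : \sum_v F v = - \sum_v F v.
  rewrite [LHS](reindex_inj (inv_inj flipK)) -sumrN.
  by apply: eq_bigr => v _; exact: Fodd.
by lra.
Qed.

Lemma sum_sign_of j : \sum_(i < #|{: signs}|) sign_of j i = 0.
Proof.
rewrite (sum_signs (fun v => (-1) ^+ v j)); apply: (sum_signs_odd (j := j)) => v.
by rewrite ffunE eqxx signrN.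
Qed.

Lemma sum_sign_of2 j x :
  \sum_(i < #|{: signs}|) sign_of x i * sign_of j i =
  #|{: signs}|%:R * (x == j)%:R.
Proof.
have [->|xj] := eqVneq x j.
  under eq_bigr do rewrite -expr2 sign_of_sqr.
  by rewrite sumr_const card_ord mulr1.
rewrite (sum_signs (fun v => (-1) ^+ v x * (-1) ^+ v j)) mulr0.
apply: (sum_signs_odd (j := j)) => v.
by rewrite !ffunE eqxx (negPf xj)/= signrN mulrN.
Qed.

End sign_code.

(** * The randomized sign channel *)

Section sign_channel.
Context (R : realType) (d : nat) (tau : R).
Hypothesis tau01 : 0 <= tau <= 1.
Notation N := #|{ffun 'I_d -> bool}|.

Let N0 : 0 < N%:R :> R.
Proof. by rewrite ltr0n; apply/card_gt0P; exists [ffun=> false]. Qed.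

Lemma sign_weight_ge0 (x : 'I_d) (i : nat) :
  0 <= (1 + tau * sign_of R x i) / N%:R.
Proof.
apply: divr_ge0; last exact: ltW.
have /andP[t0 t1] := tau01.
by rewrite /sign_of; case: (fun_of_fin _ _); rewrite /= ?expr1 ?expr0; lra.
Qed.

Definition sign_weight (x : 'I_d) (i : nat) : {nonneg R} :=
  NngNum (sign_weight_ge0 x i).

Lemma sum_sign_weight x : \sum_(i < N) (sign_weight x i)%:num = 1.
Proof.
rewrite -mulr_suml big_split/= sumr_const card_ord -mulr_sumr sum_sign_of.
by rewrite mulr0 addr0 mulfV// gt_eqF.
Qed.

(** Orthogonality of distinct sign coordinates leaves only the tilt. Averaged over X this gives mean
    tau * th j, hence unbiasedness after division by [tau]. *)
Lemma sum_sign_weight_sign x j :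
  \sum_(i < N) (sign_weight x i)%:num * sign_of R j i = tau * (x == j)%:R.
Proof.
rewrite /=; under eq_bigr do rewrite mulrAC mulrDl mul1r -mulrA.
rewrite -mulr_suml big_split/= -mulr_sumr sum_sign_of sum_sign_of2 add0r.
rewrite (mulrCA tau) mulrC.
by rewrite mulKf // gt_eqF.
Qed.

(* The view of x is a vector in {-1,1}^d, uniform except for its x-th
   coordinate, which has mean tau; it is coded by its rank in the enumeration
   of {-1,1}^d. *)
Definition sign_channel (x : 'I_d) (s : hist nat) : probability nat R :=
  finite_law (sum_sign_weight x).

End sign_channel.

(** * Privacy and risk of the sign scheme *)

Section upper_bound.
Context (R : realType).

(** All the laws share the same atoms, so weights can be compared one by one; they lie between (1 -
    tau)/N and (1 + tau)/N. *)
Lemma sign_channel_LDP (d : nat) (alpha tau : R) (tau01 : 0 <= tau <= 1) :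
  1 + tau <= expR alpha * (1 - tau) ->
  is_LDP_channel alpha (sign_channel (d := d) tau01).
Proof.
move=> tau_alpha; have /andP[t0 t1] := tau01.
split=> [x S mS|x x' s S mS]; first exact: measurable_cst.
rewrite -[leLHS]/(\sum_(i < #|{ffun 'I_d -> bool}|)
  (sign_weight tau01 x i)%:num%:E * \d_(nat_of_ord i) S)%E.
rewrite -[X in (_ * X)%E]/(\sum_(i < #|{ffun 'I_d -> bool}|)
  (sign_weight tau01 x' i)%:num%:E * \d_(nat_of_ord i) S)%E.
rewrite ge0_sume_distrr; last by move=> i _; apply: mule_ge0.
apply: lee_sum => i _; rewrite muleA -(EFinM (expR alpha)); apply: lee_wpmul2r => //.
rewrite lee_fin /= mulrA; apply: ler_wpM2r; first by rewrite invr_ge0.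
have sgn (y : 'I_d) : 1 - tau <= 1 + tau * sign_of R y i <= 1 + tau.
  by rewrite /sign_of; case: (fun_of_fin _ _); rewrite /= ?expr1 ?expr0; apply/andP; split; lra.
case/andP: (sgn x) => _ ub; case/andP: (sgn x') => lb _.
apply: (le_trans ub); apply: (le_trans tau_alpha).
by apply: ler_wpM2l => //; exact: expR_ge0.
Qed.

(** Squaring exp(alpha/2) >= 1 + alpha/2 reduces this to a cubic inequality on [0, 1/4]. The factor
    9/20 is below 1/2, which leaves room for that, yet above 1/sqrt 5, which keeps the final
    constant below 5. *)
Lemma half_alpha_LDP (alpha : R) : 0 <= alpha <= 4^-1 ->
  1 + 9 / 20 * alpha <= expR alpha * (1 - 9 / 20 * alpha).
Proof.
move=> /andP[a0 a1]; have : (1 + alpha / 2) ^+ 2 <= expR alpha.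
  have -> : alpha = 2%:R * (alpha / 2) by field.
  rewrite expRM_natl lerXn2r ?nnegrE ?expR_ge0//; first by lra.
  rewrite [X in 1 + X / 2]mulrC mulfK//; exact: expR_ge1Dx.
move=> ea; apply: (@le_trans _ _ ((1 + alpha / 2) ^+ 2 * (1 - 9 / 20 * alpha))).
  by nra.
by apply: ler_wpM2r => //; lra.
Qed.

Section sign_estimator.
Variables (d n : nat) (tau : R).
Hypothesis tau01 : 0 <= tau <= 1.
Hypothesis tau0 : 0 < tau.
Hypothesis n0 : (0 < n)%N.

Let r : R := (n%:R * tau)^-1.

Definition sign_estimator (s : hist nat) (j : 'I_d) : R :=
  r * \sum_(i <- s : seq nat) sign_of R j i.

(** Bias-variance form of the conditional risk with [m] views to come: the squared bias of the
    predicted final estimate, plus a variance r^2 (1 - (tau th_j)^2) for each of them. *)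
Let remaining_risk (th : 'I_d -> R) (m : nat) (s : hist nat) (j : 'I_d) : R :=
  (sign_estimator s j + r * (m%:R * tau * th j) - th j) ^+ 2 +
  m%:R * r ^+ 2 * (1 - (tau * th j) ^+ 2).

Lemma risk_from_sign_estimator (th : 'I_d -> R) (m : nat) (s : hist nat) :
  (0 < d)%N -> simplex th ->
  risk_from (sign_channel tau01) sign_estimator th m s =
  (\sum_(j < d) remaining_risk th m s j)%:E.
Proof.
move=> d0 [th0 th1].
have th_le1 j : th j <= 1 by rewrite -th1 (bigD1 j)//= lerDl sumr_ge0.
have /andP[_ t1] := tau01.
have tth j : 0 <= 1 - (tau * th j) ^+ 2.
  by rewrite subr_ge0 exprn_ile1// ?mulr_ge0 ?mulr_ile1// ltW.
elim: m s => [|m IH] s.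
  congr EFin; apply: eq_bigr => j _.
  by rewrite /remaining_risk /= !mul0r mulr0 !addr0.
rewrite /=.
under eq_bigr => x _.
  under eq_integral do rewrite IH.
  rewrite integral_finite_law; last first.
    move=> i; apply: sumr_ge0 => j _.
    apply: addr_ge0; first exact: sqr_ge0.
    by apply: mulr_ge0 => //; apply: mulr_ge0 => //; exact: sqr_ge0.
  rewrite -EFinM; over.
rewrite sumEFin; congr EFin.
(* As a sign squares to 1, one more view changes the remaining risk by an affine function of its
   sign, so only the mean of the sign is needed. *)
pose A j := remaining_risk th m s j + r ^+ 2.
pose B j := 2 * r * (sign_estimator s j + r * (m%:R * tau * th j) - th j).
have stepE i j : remaining_risk th m (rcons s i : hist nat) j =
    A j + B j * sign_of R j i.
  rewrite /A /B /remaining_risk.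
  have -> : sign_estimator (rcons s i : hist nat) j =
      sign_estimator s j + r * sign_of R j i.
    by rewrite /sign_estimator -cats1 big_cat/= big_seq1 mulrDr.
  have := sign_of_sqr R j i; set e := sign_of R j i => e2.
  apply/eqP; rewrite -subr_eq0; set u := sign_estimator s j.
  rewrite (_ : _ - _ = r ^+ 2 * (e ^+ 2 - 1)); last by ring.
  by rewrite e2 subrr mulr0.
have meanE x : \sum_(i < #|{ffun 'I_d -> bool}|) (sign_weight tau01 x i)%:num *
      \sum_(j < d) remaining_risk th m (rcons s (nat_of_ord i) : hist nat) j =
    \sum_(j < d) (A j + B j * (tau * (x == j)%:R)).
  under eq_bigr do rewrite mulr_sumr.
  rewrite exchange_big/=; apply: eq_bigr => j _.
  under eq_bigr do rewrite stepE mulrDr mulrCA.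
  rewrite big_split /=; congr (_ + _).
    by rewrite -mulr_suml -[RHS]mul1r; congr (_ * _); exact: sum_sign_weight.
  by rewrite -mulr_sumr; congr (_ * _); exact: sum_sign_weight_sign.
transitivity (\sum_(x < d) th x * \sum_(j < d) (A j + B j * (tau * (x == j)%:R))).
  by apply: eq_bigr => x _; congr (_ * _); exact: meanE.
transitivity (\sum_(x < d) \sum_(j < d) th x * (A j + B j * (tau * (x == j)%:R))).
  by apply: eq_bigr => x _; rewrite mulr_sumr.
rewrite exchange_big/=; apply: eq_bigr => j _.
under eq_bigr do rewrite mulrDr.
rewrite big_split/= -mulr_suml th1 mul1r (bigD1 j)//= eqxx big1 ?addr0; last first.
  by move=> x /negPf ->; rewrite !mulr0.
by rewrite /A /B /remaining_risk mulr1; ring.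
Qed.

Lemma risk_sign_estimator (th : 'I_d -> R) : (0 < d)%N -> simplex th ->
  (risk n (sign_channel tau01) sign_estimator th <=
   (d%:R / (n%:R * tau ^+ 2))%:E)%E.
Proof.
move=> d0 sth; rewrite /risk risk_from_sign_estimator// lee_fin.
have nR : 0 < n%:R :> R by rewrite ltr0n.
apply: (@le_trans _ _ (\sum_(j < d) (n%:R * tau ^+ 2)^-1)); last first.
  by rewrite sumr_const card_ord [leRHS]mulr_natl.
apply: ler_sum => j _; rewrite /remaining_risk /sign_estimator big_nil mulr0 add0r.
have -> : r * (n%:R * tau * th j) = th j.
  by rewrite /r mulrA mulVf ?mul1r// mulf_neq0 ?gt_eqF.
rewrite subrr expr0n/= add0r.
have -> : (n%:R * tau ^+ 2)^-1 = n%:R * r ^+ 2.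
  by rewrite /r; field; rewrite ?gt_eqF.
apply: ler_piMr; first by rewrite mulr_ge0// sqr_ge0.
by rewrite gerBl sqr_ge0.
Qed.

End sign_estimator.

Lemma private_minimax_le_risk (d n : nat) (alpha c : R) (dZ : measure_display)
    (Z : measurableType dZ) (Q : 'I_d -> hist Z -> probability Z R)
    (est : hist Z -> 'I_d -> R) :
  is_LDP_channel alpha Q -> is_estimator est ->
  (forall th, simplex th -> (risk n Q est th <= c%:E)%E) ->
  (private_minimax d n alpha <= c%:E)%E.
Proof.
move=> Qldp mest le_c; apply: (@le_trans _ _
  (ereal_sup [set risk n Q est th | th in @simplex R d])).
  by apply: ereal_inf_lbound; exists dZ, Z, Q, est.
by apply: ge_ereal_sup => _ [th sth <-]; exact: le_c.
Qed.

Lemma private_minimax_le (d n : nat) (alpha : R) :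
  (0 < d)%N -> (0 < n)%N -> 0 <= alpha <= 4^-1 ->
  (private_minimax d n alpha <= (400 / 81)%:E * upper_rate d n alpha)%E.
Proof.
move=> d0 n0 a01; have /andP[a0 a1] := a01.
have tau01 : 0 <= 9 / 20 * alpha <= 1 by apply/andP; split; lra.
have Qldp := sign_channel_LDP d tau01 (half_alpha_LDP a01).
(* The zero estimator has risk sum_j th_j^2 <= sum_j th_j = 1. *)
have le1 : (private_minimax d n alpha <= 1)%E.
  apply: (private_minimax_le_risk Qldp (est := fun _ _ => 0)) => [j|th [th0 th1]].
    exact: measurable_cst.
  rewrite /risk risk_fromE.
  rewrite (iterE_cst _ th1 (sqloss (fun=> 0) th)) lee_fin -th1.
  apply: ler_sum => j _; rewrite sub0r sqrrN expr2 ler_piMl//.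
  by rewrite -th1 (bigD1 j)//= lerDl sumr_ge0.
rewrite /upper_rate minEle; case: ifP => _.
  by rewrite mule1 (le_trans le1)// lee_fin; lra.
(* A zero denominator makes the quotient infinite, because [d > 0]. *)
rewrite /ediv inver; case: eqP => [_|/eqP nz].
  by rewrite gt0_muley ?lte_fin ?ltr0n// gt0_muley ?leey// lte_fin; lra.
have nR : 0 < n%:R :> R by rewrite ltr0n.
have apos : 0 < alpha.
  by rewrite lt_neqAle a0 andbT eq_sym; apply: contraNneq nz => ->; rewrite expr0n mulr0.
rewrite -!EFinM.
have -> : 400 / 81 * (d%:R / (n%:R * alpha ^+ 2)) =
    d%:R / (n%:R * (9 / 20 * alpha) ^+ 2) :> R.
  by field; rewrite !gt_eqF.
apply: (private_minimax_le_risk Qldp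
  (est := @sign_estimator d n (9 / 20 * alpha))) => [j|th sth].
  by move=> _ A _; exact: measurable_hist_nat.
by apply: risk_sign_estimator => //; lra.
Qed.

End upper_bound.

Theorem theorem1 (R : realType) :
  exists cl cu : R, 0 < cl /\ cl <= cu /\ cu < 5 /\
    forall (d n : nat), (1 <= d)%N -> (1 <= n)%N ->
    forall alpha : R, 0 <= alpha <= 4^-1 ->
      (cl%:E * lower_rate d n alpha <= private_minimax d n alpha)%E /\
      (private_minimax d n alpha <= cu%:E * upper_rate d n alpha)%E.
Proof.
(* The lower bound loses 16 in [sup_risk_packing], 16 in the choice of eta^2 and 3 in halving [k],
   and 768 <= 32^2. The upper constant is (20/9)^2, from tau = 9 alpha / 20. *)
exists (32^-1 ^+ 2), (400 / 81).
have c0 : 0 < 32^-1 ^+ 2 :> R by rewrite exprn_gt0// invr_gt0.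
split=> //; split; first by lra.
split; first by lra.
move=> d n d0 n0 alpha a01; split.
  by apply: private_minimax_ge => //; rewrite c0 lexx.
exact: private_minimax_le.
Qed.
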